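(* Let $q\in\mathbb{R}$. Every contact magnetic geodesic $\gamma(s)$ of charge $q$ in $\mathrm{Nil}_3$ starting at the origin, $\gamma(0)=o=(0,0,0)$, is $\mathrm{Osc}$-homogeneous and is represented by \[ \gamma(s)=\exp_{\mathfrak{osc}}\bigl(s(W+qE_4)\bigr)\cdot o \] for some $W\in\mathfrak{m}=\mathrm{span}\{E_1,E_2,E_3+E_4\}\subset\mathfrak{osc}$.
   Context: **Heisenberg group.** $\mathrm{Nil}_3$ is $\mathbb{R}^3(x,y,z)$ with multiplication $(x_1,y_1,z_1)(x_2,y_2,z_2)=\left(x_1+x_2,\,y_1+y_2,\,z_1+z_2+\tfrac12(x_1y_2-x_2y_1)\right)$, origin $o=(0,0,0)$, equipped with the left invariant Riemannian metric $g=dx^2+dy^2+\left(dz+\tfrac12(y\,dx-x\,dy)\right)^2$. The left invariant vector fields $E_1=\partial_x-\tfrac{y}{2}\partial_z$, $E_2=\partial_y+\tfrac{x}{2}\partial_z$, $E_3=\partial_z$ form an orthonormal frame. The contact form is $\alpha=dz+\tfrac12(y\,dx-x\,dy)$, with Reeb vector field $E_3$. $\nabla$ denotes the Levi-Civita connection of $g$. **Contact magnetic geodesics.** Let $J$ be the left invariant endomorphism field with $JE_1=E_2$, $JE_2=-E_1$, $JE_3=0$ (the Lorentz force of the contact magnetic field). For a real constant $q$ (the charge), a contact magnetic geodesic of charge $q$ is a smooth curve $\gamma(s)$ in $\mathrm{Nil}_3$ satisfying the Lorentz equation $\nabla_{\dot\gamma}\dot\gamma=qJ\dot\gamma$. **Oscillator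 group and algebra.** The oscillator group is $\mathrm{Osc}=\{\mathsf{M}(x,y,z,t)\mid x,y,z,t\in\mathbb{R}\}\subset\mathrm{GL}_4\mathbb{R}$, where \[ \mathsf{M}(x,y,z,t)=\begin{pmatrix}1& x\sin t-y\cos t& x\cos t+y\sin t&2z\\0&\cos t&-\sin t&x\\0&\sin t&\cos t&y\\0&0&0&1\end{pmatrix}. \] It acts transitively and isometrically on $\mathrm{Nil}_3$ by $\mathsf{M}(a,b,c,t)\cdot(x,y,z)=\left(a+x\cos t-y\sin t,\ b+x\sin t+y\cos t,\ c+z+\tfrac12\bigl(\cos t\,(ay-bx)+\sin t\,(ax+by)\bigr)\right)$, with isotropy group $\mathrm{U}(1)=\{\mathsf{M}(0,0,0,t)\}$ at $o$. Its Lie algebra $\mathfrak{osc}$ consists of the matrices \[ m(x,y,z,t)=\begin{pmatrix}0&-y&x&2z\\0&0&-t&x\\0&t&0&y\\0&0&0&0\end{pmatrix}, \] with basis (denoted by the same symbols) $E_1=m(1,0,0,0)$, $E_2=m(0,1,0,0)$, $E_3=m(0,0,1,0)$, $E_4=m(0,0,0,1)$; the nonzero brackets are determined by $[E_1,E_2]=E_3$, $[E_4,E_1]=E_2$, $[E_4,E_2]=-E_1$. The exponential map $\exp_{\mathfrak{osc}}:\mathfrak{osc}\to\mathrm{Osc}$ is the matrix exponential. **Homogeneity.** A curve $\gamma(s)$ in $\mathrm{Nil}_3$ with $\gamma(0)=o$ is $\mathrm{Osc}$-homogeneous if $\gamma(s)=\exp_{\mathfrak{osc}}(sV)\cdot o$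 for some $V\in\mathfrak{osc}$. *)

(* Defs.v *)
(* MathComp / MathComp-Analysis *)
From mathcomp Require Import all_boot all_order all_algebra.
From mathcomp Require Import all_classical all_reals all_analysis.
From mathcomp Require Import ring lra.

Set Implicit Arguments.
Unset Strict Implicit.
Unset Printing Implicit Defensive.

Import Order.TTheory GRing.Theory Num.Theory.
Import numFieldNormedType.Exports.

Local Open Scope ring_scope.
Local Open Scope classical_set_scope.

Section Riemannian.
Variables (R : realType) (n : nat).
Local Notation point := 'rV[R]_n.+1.
Implicit Types (G : point -> 'M[R]_n.+1) (p : point).

(* A Riemannian metric on R^(n+1) is given by the matrix field
   G p i j = g_p(d_i, d_j). *)

Definition partial (i : 'I_n.+1) (f : point -> R) (p : point) : R :=
  'D_(delta_mx 0 i) f p.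

(* christoffel G p i j k is Gamma^k_ij, the d_k-component of nabla_(d_i) d_j at
   p, for the Levi-Civita connection nabla of G (see christoffel_torsion_free,
   christoffel_metric and christoffel_unique). *)
Definition christoffel G p (i j k : 'I_n.+1) : R :=
  2^-1 * \sum_l invmx (G p) k l *
    (partial i (fun x => G x j l) p + partial j (fun x => G x i l) p
     - partial l (fun x => G x i j) p).

(* Covariant derivative of a vector field X along the curve c. *)
Definition covariant_derivative G (c X : R -> point) (s : R) : point :=
  \row_k (derive1 X s 0 k +
    \sum_i \sum_j christoffel G (c s) i j k * derive1 c s 0 i * X s 0 j).

Definition smooth_on (I : set R) (c : R -> point) : Prop :=
  forall m s, I s -> derivable (derive1n m c) s 1.

Lemma christoffel_lower G p i j m : G p \in unitmx ->
  (forall x, (G x)^T = G x) ->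
  \sum_k christoffel G p i j k * G p k m =
  2^-1 * (partial i (fun x => G x j m) p + partial j (fun x => G x i m) p
     - partial m (fun x => G x i j) p).
Proof.
move=> Gu Gsym; rewrite /christoffel.
pose d l := partial i (fun x => G x j l) p + partial j (fun x => G x i l) p
     - partial l (fun x => G x i j) p.
rewrite -/(d m).
have Gs k l : G p k l = G p l k by rewrite -[in LHS]Gsym mxE.
have -> : d m = \sum_l (G p *m invmx (G p)) m l * d l.
  rewrite mulmxV // (bigD1 m) //= mxE eqxx mul1r big1 ?addr0 // => l lm.
  by rewrite mxE eq_sym (negPf lm) mul0r.
rewrite mulr_sumr.
under eq_bigr do rewrite -mulrA mulr_suml mulr_sumr.
rewrite exchange_big /=; apply: eq_bigr => l _.
rewrite mxE mulr_suml mulr_sumr; apply: eq_bigr => k _.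
by rewrite -/(d l) (Gs k m); ring.
Qed.

Lemma christoffel_torsion_free G p i j k : (forall x, (G x)^T = G x) ->
  christoffel G p i j k = christoffel G p j i k.
Proof.
move=> Gsym; rewrite /christoffel; congr (_ * _); apply: eq_bigr => l _.
have -> : (fun x => G x i j) = (fun x => G x j i).
  by apply/funext => x; rewrite -[in LHS]Gsym mxE.
by congr (_ * (_ - _)); rewrite addrC.
Qed.

Lemma christoffel_metric G p i j k : G p \in unitmx ->
  (forall x, (G x)^T = G x) ->
  partial k (fun x => G x i j) p =
  \sum_l christoffel G p k i l * G p l j + \sum_l christoffel G p k j l * G p i l.
Proof.
move=> Gu Gsym.
have Gf a b : (fun x => G x a b) = (fun x => G x b a).
  by apply/funext => x; rewrite -[in LHS]Gsym mxE.
under [X in _ + X]eq_bigr do rewrite -[G p]Gsym mxE.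
by rewrite !christoffel_lower // (Gf j i); field.
Qed.

Lemma christoffel_unique G p (C : 'I_n.+1 -> 'I_n.+1 -> 'I_n.+1 -> R) :
  G p \in unitmx -> (forall x, (G x)^T = G x) ->
  (forall i j k, C i j k = C j i k) ->
  (forall i j k, partial k (fun x => G x i j) p =
     \sum_l C k i l * G p l j + \sum_l C k j l * G p i l) ->
  forall i j k, C i j k = christoffel G p i j k.
Proof.
move=> Gu Gsym Csym Cmet i j k.
pose L a b m := \sum_l C a b l * G p l m.
have LE a b m : \sum_l C a b l * G p m l = L a b m.
  by apply: eq_bigr => l _; rewrite -[in LHS]Gsym mxE.
have LC a b m : L a b m = L b a m by apply: eq_bigr => l _; rewrite Csym.
have e m : L i j m = \sum_k christoffel G p i j k * G p k m.
  have Cmet' a b d : partial d (fun x => G x a b) p = L d a b + L d b a.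
    by rewrite Cmet LE.
  by rewrite christoffel_lower // !Cmet' (LC m j) (LC m i) (LC j i); field.
pose u := \row_l C i j l; pose v := \row_l christoffel G p i j l.
suff /rowP/(_ k) : u = v by rewrite !mxE.
apply: (can_inj (mulmxK Gu)); apply/rowP => m; rewrite !mxE.
rewrite (eq_bigr (fun l => C i j l * G p l m)); last by move=> l _; rewrite mxE.
rewrite -/(L i j m) e; apply: eq_bigr => l _; by rewrite mxE.
Qed.

End Riemannian.

Section Nil3.
Variable R : realType.
Local Notation Nil3 := 'rV[R]_3.
Implicit Types (p u v : Nil3).

Definition vec3 (x y z : R) : Nil3 := \row_(i < 3) [:: x; y; z]`_i.

Definition nil_mul p u : Nil3 :=
  vec3 (p 0 0 + u 0 0) (p 0 1 + u 0 1)
    (p 0 2 + u 0 2 + 2^-1 * (p 0 0 * u 0 1 - u 0 0 * p 0 1)).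

Definition contact_form p v : R :=
  v 0 2 + 2^-1 * (p 0 1 * v 0 0 - p 0 0 * v 0 1).

Definition nil_g p u v : R :=
  u 0 0 * v 0 0 + u 0 1 * v 0 1 + contact_form p u * contact_form p v.

Definition nil_metric p : 'M[R]_3 :=
  \matrix_(i, j) nil_g p (delta_mx 0 i) (delta_mx 0 j).

Definition nilE1 p : Nil3 := vec3 1 0 (- (p 0 1 / 2)).
Definition nilE2 p : Nil3 := vec3 0 1 (p 0 0 / 2).
Definition nilE3 p : Nil3 := vec3 0 0 1.

(* (nilE1, nilE2, nilE3) is orthonormal, so this is the linear field with
   J E1 = E2, J E2 = - E1, J E3 = 0 (see nilJ_frame). *)
Definition nilJ p v : Nil3 :=
  nil_g p v (nilE1 p) *: nilE2 p - nil_g p v (nilE2 p) *: nilE1 p.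

(* Only the values of c on the open interval I matter. *)
Definition contact_magnetic_geodesic (q : R) (I : set R) (c : R -> Nil3) : Prop :=
  smooth_on I c /\
  forall s, I s ->
    covariant_derivative nil_metric c (derive1 c) s = q *: nilJ (c s) (derive1 c s).

Lemma ord3P (P : 'I_3 -> Prop) : P 0 -> P 1 -> P 2 -> forall i, P i.
Proof.
move=> P0 P1 P2 [[|[|[|//]]] h].
- by rewrite (_ : Ordinal h = 0) //; apply: val_inj.
- by rewrite (_ : Ordinal h = 1) //; apply: val_inj.
- by rewrite (_ : Ordinal h = 2) //; apply: val_inj.
Qed.

Lemma sum3E (f : 'I_3 -> R) : \sum_i f i = f 0 + f 1 + f 2.
Proof.
rewrite !big_ord_recr big_ord0 /= add0r.
by congr (f _ + f _ + f _); apply: val_inj.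
Qed.

Lemma nil_metric_sym p : (nil_metric p)^T = nil_metric p.
Proof. by apply/matrixP => i j; rewrite !mxE /nil_g; ring. Qed.

Lemma nil_metricE p u v : nil_g p u v = (u *m nil_metric p *m v^T) 0 0.
Proof.
by rewrite !mxE sum3E !mxE !sum3E !mxE /nil_g /contact_form !mxE /=; field.
Qed.

Lemma nil_frame_orthonormal p :
  [/\ nil_g p (nilE1 p) (nilE1 p) = 1, nil_g p (nilE2 p) (nilE2 p) = 1 &
      nil_g p (nilE3 p) (nilE3 p) = 1] /\
  [/\ nil_g p (nilE1 p) (nilE2 p) = 0, nil_g p (nilE1 p) (nilE3 p) = 0 &
      nil_g p (nilE2 p) (nilE3 p) = 0].
Proof. by rewrite /nil_g /contact_form !mxE /=; split; split; field. Qed.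

Lemma nil_metric_unit p : nil_metric p \in unitmx.
Proof.
pose x := p 0 0; pose y := p 0 1.
pose H : 'M[R]_3 := \matrix_(i < 3) [:: vec3 1 0 (- (y / 2)); vec3 0 1 (x / 2);
  vec3 (- (y / 2)) (x / 2) (1 + (x ^+ 2 + y ^+ 2) / 4)]`_i.
suff /mulmx1_unit[] : nil_metric p *m H = 1%:M by [].
apply/matrixP; apply: ord3P; apply: ord3P;
  by rewrite !mxE sum3E !mxE /= /nil_g /contact_form !mxE /= -/x -/y; field.
Qed.

Lemma nilJ_frame p :
  [/\ nilJ p (nilE1 p) = nilE2 p, nilJ p (nilE2 p) = - nilE1 p &
      nilJ p (nilE3 p) = 0].
Proof.
have [[e11 e22 e33] [e12 e13 e23]] := nil_frame_orthonormal p.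
have gC u v : nil_g p u v = nil_g p v u by rewrite /nil_g; ring.
rewrite /nilJ e11 e22 (gC (nilE2 p)) (gC (nilE3 p)) (gC (nilE3 p)) e12 e13 e23.
by rewrite !scale1r !scale0r subr0 sub0r subrr.
Qed.

Lemma nil_frame_left_invariant p t :
  [/\ nil_mul p (t *: nilE1 0) = p + t *: nilE1 p,
      nil_mul p (t *: nilE2 0) = p + t *: nilE2 p &
      nil_mul p (t *: nilE3 0) = p + t *: nilE3 p].
Proof.
by split; apply/rowP; apply: ord3P; rewrite !mxE /=; field.
Qed.

End Nil3.

Section Oscillator.
Variable R : realType.

Definition mx4 (r : seq (seq R)) : 'M[R]_4 := \matrix_(i < 4, j < 4) (nth [::] r i)`_j.

Definition oscM (x y z t : R) : 'M[R]_4 := mx4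
  [:: [:: 1; x * sin t - y * cos t; x * cos t + y * sin t; 2 * z];
      [:: 0; cos t; - sin t; x];
      [:: 0; sin t; cos t; y];
      [:: 0; 0; 0; 1]].

Definition oscm (x y z t : R) : 'M[R]_4 := mx4
  [:: [:: 0; - y; x; 2 * z];
      [:: 0; 0; - t; x];
      [:: 0; t; 0; y];
      [:: 0; 0; 0; 0]].

Definition osc : set 'M[R]_4 := [set V | exists x y z t, V = oscm x y z t].

Definition oscE1 : 'M[R]_4 := oscm 1 0 0 0.
Definition oscE2 : 'M[R]_4 := oscm 0 1 0 0.
Definition oscE3 : 'M[R]_4 := oscm 0 0 1 0.
Definition oscE4 : 'M[R]_4 := oscm 0 0 0 1.

Definition osc_m : {vspace 'M[R]_4} := <<[:: oscE1; oscE2; (oscE3 + oscE4)%R]>>%VS.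

Definition expmx (n : nat) (A : 'M[R]_n.+1) : 'M[R]_n.+1 :=
  limn (series (fun k => k`!%:R^-1 *: A ^+ k)).

(* The action of A = M(a,b,c,t), whose parameters a, b, c, cos t, sin t are
   read off its entries (see osc_act_oscM); only meaningful for A in Osc. *)
Definition osc_act (A : 'M[R]_4) (p : 'rV[R]_3) : 'rV[R]_3 :=
  let a := A 1 3 in let b := A 2 3 in let c := A 0 3 / 2 in
  let cost := A 1 1 in let sint := A 2 1 in
  let x := p 0 0 in let y := p 0 1 in let z := p 0 2 in
  vec3 (a + x * cost - y * sint) (b + x * sint + y * cost)
    (c + z + 2^-1 * (cost * (a * y - b * x) + sint * (a * x + b * y))).

Lemma osc_act_oscM a b c t x y z :
  osc_act (oscM a b c t) (vec3 x y z) =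
  vec3 (a + x * cos t - y * sin t) (b + x * sin t + y * cos t)
    (c + z + 2^-1 * (cos t * (a * y - b * x) + sin t * (a * x + b * y))).
Proof. by rewrite /osc_act !mxE /=; congr vec3; field. Qed.

Definition Osc_homogeneous (I : set R) (c : R -> 'rV[R]_3) : Prop :=
  exists V, osc V /\ forall s, I s -> c s = osc_act (expmx (s *: V)) 0.

End Oscillator.

(* Main.v *)
Require Import Defs.
From mathcomp Require Import all_boot all_order all_algebra.
From mathcomp Require Import all_classical all_reals all_analysis.
From mathcomp Require Import ring.
Import Order.TTheory GRing.Theory Num.Theory.
Import numFieldNormedType.Exports.
Local Open Scope ring_scope.
Local Open Scope classical_set_scope.

(** The Lorentz equation is first reduced to linear differential equations
    with constant coefficients, which the matrix exponential then solves.

    Write a velocity as [A E1 + B E2 + C E3], with [C] its value under the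
    contact form.  In this frame the Lorentz equation reads
    [A' = - (C + q) B], [B' = (C + q) A], [C' = 0] ([geodesic_equations]).  To
    avoid inverting the metric, the equation is lowered by contraction with
    [g], which leaves only Christoffel symbols of the first kind; those are
    polynomial because [g] is the square of the contact form plus a form with
    constant coefficients.

    So [C] is constant, equal to [w := z' 0].  Put [t := w + q], [u := x' 0]
    and [v := y' 0].  The equations for [A = x'] and [B = y'] integrate to
    [x' = u - t y] and [y' = v + t x].  The equation [C = w] for [z'] is still
    quadratic in [x] and [y], but the projected curve satisfies the equation
    [t (x ^ 2 + y ^ 2) = 2 u y - 2 v x]
    of a circle through the origin (of a line if [t = 0]), because the
    difference of the two sides has derivative zero.  Substituting it makes
    [z'] affine: [2 z' = 2 w - v x + u y] ([magnetic_first_integrals]).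

    These three affine equations say exactly that the column
    [(2 z, x, y, 1)] has derivative [oscm u v w t] times itself.  Matrix
    solutions of [X' = V X] are [expmx (s V) X(0)] ([expmx_ode]), so the
    column is the last one of [expmx (s *: oscm u v w t)], from which the
    action of that matrix on the origin is read off ([osc_orbit_ode]).
    Finally [oscm u v w (w + q)] is
    [u E1 + v E2 + w (E3 + E4) + q E4] ([oscm_in_osc_m]). *)

Set Implicit Arguments.
Unset Strict Implicit.
Unset Printing Implicit Defensive.

(** * Linear differential equations and the matrix exponential *)

Section MatrixODE.
Context {R : realType}.

Lemma derive0_interval_constant (I : set R) (f : R -> R) :
  is_interval I -> (forall s, I s -> is_derive s (1 : R) f 0) ->
  forall a b, I a -> I b -> f a = f b.
Proof.
move=> Iint df a b Ia Ib.
wlog ab : a b Ia Ib / a <= b.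
  by move=> H; case: (leP a b) => [/H->//|/ltW /H <-].
have Iab x : a <= x <= b -> I x by apply: Iint.
have [||c _ ] := @MVT_segment _ f (cst 0) _ _ ab.
- by move=> x /[!in_itv]/= /andP[/ltW ax /ltW xb]; apply/df/Iab/andP.
- apply: derivable_within_continuous => x /[!in_itv]/= xab.
  exact: (@ex_derive _ _ _ _ _ _ _ (df x (Iab _ xab))).
- by rewrite mul0r => /eqP /[!subr_eq0] /eqP.
Qed.

Lemma cvg_mxP (T : Type) (F : set_system T) (FF : Filter F) m n
    (M : T -> 'M[R]_(m, n)) (L : 'M[R]_(m, n)) :
  (forall i j, M x i j @[x --> F] --> L i j) -> M @ F --> L.
Proof.
move=> ML; apply/cvgrPdist_le => /= e e0; near=> x.
rewrite /Num.Def.normr/= mx_normrE (bigmax_le _ (ltW e0))//= => i _.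
rewrite !mxE/=; move: i; near: x; apply: filter_forall => /= i.
exact: ((cvgrPdist_le _ _).1 (ML i.1 i.2)).
Unshelve. all: by end_near. Qed.

(** Comparison with the series of [C * exp (K * `|x|)]. *)
Lemma exp_dominated_cvg (a : nat -> R) (C K x : R) :
  0 <= C -> 0 <= K -> (forall k, `|a k| <= C * (K ^+ k / k`!%:R)) ->
  cvgn (pseries a x).
Proof.
move=> C0 K0 aK; apply: normed_cvg.
apply: (@series_le_cvg _ _ (C *: exp_coeff (K * `|x|))) => [k|k|k|].
- exact: normr_ge0.
- by rewrite fctE /= mulr_ge0 // exp_coeff_ge0 // mulr_ge0.
- rewrite fctE /= /exp_coeff /= normrM normrX.
  apply: (le_trans (ler_wpM2r _ (aK k))); first exact: exprn_ge0.
  by rewrite exprMn /GRing.scale /= -!mulrA [_ ^-1 * _]mulrC.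
- exact/is_cvg_seriesZ/is_cvg_series_exp_coeff.
Qed.

Section MatrixExponential.
Variables (n : nat) (V : 'M[R]_n.+1).

Definition expmx_coef (i j : 'I_n.+1) (k : nat) : R := (V ^+ k) i j / k`!%:R.

(* A submultiplicative bound for the entries: [K] dominates every row sum of
   absolute values, so the entries of [V ^+ k] are at most [K ^+ k]. *)
Let K : R := \sum_i \sum_j `|V i j|.

Let K_ge0 : 0 <= K.
Proof. by apply: sumr_ge0 => i _; apply: sumr_ge0. Qed.

Let power_le k i j : `|(V ^+ k) i j| <= K ^+ k.
Proof.
elim: k i j => [|k IH] i j.
  by rewrite !expr0 !mxE; case: (_ == _); rewrite ?normr1 ?normr0.
rewrite !exprS mxE (le_trans (ler_norm_sum _ _ _)) //.
apply: (@le_trans _ _ (\sum_l `|V i l| * K ^+ k)).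
  by apply: ler_sum => l _; rewrite normrM ler_wpM2l.
rewrite -mulr_suml ler_wpM2r ?exprn_ge0 //.
rewrite /K [leRHS](bigD1 i) //= lerDl; apply: sumr_ge0 => l _; exact: sumr_ge0.
Qed.

(* Differentiating a power series termwise [d] times shifts the power of [V]
   by [d]; all the derived series are dominated by the same exponential. *)
Let coef_shift_le d i j k :
  `|(V ^+ (k + d)) i j / k`!%:R| <= K ^+ d * (K ^+ k / k`!%:R).
Proof.
rewrite normrM (ger0_norm (_ : 0 <= k`!%:R^-1)) ?invr_ge0 // mulrA.
by rewrite ler_wpM2r ?invr_ge0 // -exprD addnC power_le.
Qed.

Let diffsE d i j :
  pseries_diffs (fun k => (V ^+ (k + d)) i j / k`!%:R) =
  (fun k => (V ^+ (k + d.+1)) i j / k`!%:R).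
Proof.
apply/funext => k; rewrite /pseries_diffs addnS addSn factS natrM invfM.
by rewrite mulrCA [_.+1%:R * _]mulrA divff ?mul1r // pnatr_eq0.
Qed.

Let cvg_shift d i j x : cvgn (pseries (fun k => (V ^+ (k + d)) i j / k`!%:R) x).
Proof.
exact: exp_dominated_cvg (exprn_ge0 d K_ge0) K_ge0 (coef_shift_le d i j).
Qed.

Let coefE i j : expmx_coef i j = (fun k => (V ^+ (k + 0)) i j / k`!%:R).
Proof. by apply/funext => k; rewrite addn0. Qed.

Lemma expmx_coef_cvg i j x : cvgn (pseries (expmx_coef i j) x).
Proof. by rewrite coefE; exact: cvg_shift. Qed.

(** Reduces the matrix exponential to scalar power series in [x], for which
    termwise differentiation is available. *)
Lemma expmx_entry x i j : expmx (x *: V) i j = limn (pseries (expmx_coef i j) x).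
Proof.
pose L : 'M[R]_n.+1 := \matrix_(i, j) limn (pseries (expmx_coef i j) x).
suff SL : series (fun k => k`!%:R^-1 *: (x *: V) ^+ k) @ \oo --> L.
  by rewrite /expmx (cvg_lim _ SL) ?mxE.
apply: cvg_mxP => a b; rewrite mxE.
have -> : (fun N => series (fun k => k`!%:R^-1 *: (x *: V) ^+ k) N a b) =
    pseries (expmx_coef a b) x.
  apply/funext => N; rewrite /pseries /series /= summxE.
  apply: eq_bigr => k _; rewrite exprZn !mxE /expmx_coef; ring.
exact: expmx_coef_cvg.
Qed.

Lemma expmx_diffs_mull x i j :
  limn (pseries (pseries_diffs (expmx_coef i j)) x) = (V *m expmx (x *: V)) i j.
Proof.
rewrite mxE; under eq_bigr do rewrite expmx_entry.
apply/cvg_lim => //.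
have -> : pseries (pseries_diffs (expmx_coef i j)) x =
    (fun N => \sum_l V i l * pseries (expmx_coef l j) x N).
  apply/funext => N; rewrite /pseries /series /= coefE diffsE.
  under [RHS]eq_bigr do rewrite mulr_sumr.
  rewrite exchange_big /=; apply: eq_bigr => k _.
  rewrite addn1 exprS mxE !mulr_suml; apply: eq_bigr => l _.
  by rewrite /expmx_coef !mulrA.
apply: cvg_big => [|l _]; first exact: add_continuous.
by apply: cvgMl_tmp; exact: expmx_coef_cvg.
Qed.

Lemma expmx_comm x : V *m expmx (x *: V) = expmx (x *: V) *m V.
Proof.
apply/matrixP => i j; rewrite -expmx_diffs_mull mxE.
under eq_bigr do rewrite expmx_entry.
apply/cvg_lim => //.
have -> : pseries (pseries_diffs (expmx_coef i j)) x =
    (fun N => \sum_l pseries (expmx_coef i l) x N * V l j).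
  apply/funext => N; rewrite /pseries /series /= coefE diffsE.
  under [RHS]eq_bigr do rewrite mulr_suml.
  rewrite exchange_big /=; apply: eq_bigr => k _.
  rewrite addn1 exprSr mxE !mulr_suml; apply: eq_bigr => l _.
  by rewrite /expmx_coef; ring.
apply: cvg_big => [|l _]; first exact: add_continuous.
by apply: cvgMr_tmp; exact: expmx_coef_cvg.
Qed.

Lemma expmx_derive (x : R) i j :
  is_derive x (1 : R) (fun t => expmx (t *: V) i j) ((V *m expmx (x *: V)) i j).
Proof.
rewrite -expmx_diffs_mull; under eq_fun do rewrite expmx_entry.
(* The series are entire, so any radius larger than [`|x|] will do. *)
apply: (@pseries_snd_diffs _ _ (`|x| + 1)).
- exact: expmx_coef_cvg.
- by rewrite coefE diffsE; exact: cvg_shift.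
- by rewrite coefE !diffsE; exact: cvg_shift.
- by rewrite [ltRHS]ger0_norm ?ltrDl // addr_ge0.
Qed.

Lemma expmx0 : expmx (0 *: V) = 1.
Proof.
apply/matrixP => i j; rewrite expmx_entry; apply/cvg_lim => //.
(* At [0] the partial sums are constant, except the empty one. *)
rewrite -(cvg_shiftn 1); apply: cvg_near_cst; near=> N.
rewrite /pseries /series /= addn1 big_nat_recl // big1_seq => [|k _].
  by rewrite /expmx_coef expr0 fact0 divr1 mulr1 addr0.
by rewrite exprS mul0r mulr0.
Unshelve. all: by end_near. Qed.

End MatrixExponential.

(** The integrating factor: in the derivative of the product, the term from
    [expmx (s *: - V)] cancels the term from [X], so the product is constant. *)
Lemma expmxN_ode n m (V : 'M[R]_n.+1) (I : set R) (X : R -> 'M[R]_(n.+1, m)) :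
  is_interval I -> I 0 ->
  (forall s i j, I s -> is_derive s (1 : R) (fun t => X t i j) ((V *m X s) i j)) ->
  forall s, I s -> expmx (s *: - V) *m X s = X 0.
Proof.
move=> Iint I0 dX s Is.
have e0 : expmx (0 *: - V) *m X 0 = X 0 by rewrite expmx0 mul1mx.
rewrite -[RHS]e0; apply/matrixP => i j.
pose f t := (expmx (t *: - V) *m X t) i j; rewrite -/(f s) -/(f 0).
apply: derive0_interval_constant Iint _ s 0 Is I0.
move=> t It; rewrite /f; under eq_fun do rewrite mxE.
have dP k : is_derive t (1 : R) (fun r => expmx (r *: - V) i k * X r k j)
    (expmx (t *: - V) i k * (V *m X t) k j
     + X t k j * (expmx (t *: - V) *m - V) i k).
  rewrite -expmx_comm.
  exact: (is_deriveM (expmx_derive (- V) t i k) (dX t k j It)).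
rewrite (_ : (fun _ => _) =
    \sum_k (fun r => expmx (r *: - V) i k * X r k j)); last first.
  by apply/funext => r; rewrite fct_sumE.
apply: is_derive_eq; rewrite big_split /=.
have -> : \sum_k expmx (t *: - V) i k * (V *m X t) k j =
    (expmx (t *: - V) *m (V *m X t)) i j by rewrite mxE.
under [X in _ + X]eq_bigr do rewrite mulrC.
have -> : \sum_k (expmx (t *: - V) *m - V) i k * X t k j =
    (expmx (t *: - V) *m - V *m X t) i j by rewrite [RHS]mxE.
by rewrite mulmxN mulNmx mulmxA [X in _ + X]mxE subrr.
Qed.

(** [expmx (t *: V)] is itself a solution, which inverts the integrating
    factor. *)
Lemma expmxNK n (V : 'M[R]_n.+1) x : expmx (x *: - V) *m expmx (x *: V) = 1%:M.
Proof.
rewrite -[RHS](expmx0 V).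
apply: (expmxN_ode (I := setT) (X := fun t => expmx (t *: V))) => //.
by move=> s i j _; exact: expmx_derive.
Qed.

Lemma expmx_ode n m (V : 'M[R]_n.+1) (I : set R) (X : R -> 'M[R]_(n.+1, m)) :
  is_interval I -> I 0 ->
  (forall s i j, I s -> is_derive s (1 : R) (fun t => X t i j) ((V *m X s) i j)) ->
  forall s, I s -> X s = expmx (s *: V) *m X 0.
Proof.
move=> Iint I0 dX s Is; rewrite -(expmxN_ode Iint I0 dX Is) mulmxA.
by rewrite (mulmx1C (expmxNK V s)) mul1mx.
Qed.
End MatrixODE.

(** * The Lorentz equation in the left invariant frame *)

Section Geodesics.
Context {R : realType}.

Lemma is_derive_mxP (W : normedModType R) m n (M : W -> 'M[R]_(m, n)) (t v : W) dM :
  is_derive t v M dM ->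
  forall i j, is_derive t v (fun x => M x i j) (dM i j).
Proof.
move=> dMt i j; have Mt := @ex_derive _ _ _ _ _ _ _ dMt.
split; first by have /derivable_mxP := Mt.
by rewrite -(@derive_val _ _ _ _ _ _ _ dMt) derive_mx // mxE.
Qed.

(** The partial derivative along [d_k] of the [i]-th component of the contact
    form; it is constant since the components are affine. *)
Definition contact_partial (k i : 'I_3) : R :=
  2^-1 * ((k == 1)%:R * (i == 0)%:R - (k == 0)%:R * (i == 1)%:R).

Lemma contact_form_derive (p : 'rV[R]_3) k i :
  is_derive p (delta_mx 0 k) (fun x => contact_form x (delta_mx 0 i))
    (contact_partial k i).
Proof.
have d j := is_derive_mxP (is_derive_id p (delta_mx 0 k)) 0 j.
have d0 := d 0; have d1 := d 1.
pose e : 'rV[R]_3 := delta_mx 0 i.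
have -> : (fun x => contact_form x (delta_mx 0 i)) =
  cst (e 0 2) + 2^-1 \*: ((e 0 0 \*: (fun x : 'rV[R]_3 => x 0 1))
                           - e 0 1 \*: (fun x : 'rV[R]_3 => x 0 0)).
  by apply/funext => x; rewrite /contact_form !fctE /= /GRing.scale /=; ring.
apply: is_derive_eq; rewrite /e /contact_partial !mxE /GRing.scale /=.
by rewrite ![_ == k]eq_sym ![_ == i]eq_sym; ring.
Qed.

(** Leibniz rule: up to an additive constant, each entry of the metric is a
    product of two components of the contact form. *)
Lemma nil_metric_partial (p : 'rV[R]_3) k i j :
  partial k (fun x => nil_metric x i j) p =
  contact_partial k i * contact_form p (delta_mx 0 j) +
  contact_form p (delta_mx 0 i) * contact_partial k j.
Proof.
have di := contact_form_derive p k i.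
have dj := contact_form_derive p k j.
rewrite /partial.
pose e (l : 'I_3) : 'rV[R]_3 := delta_mx 0 l.
have -> : (fun x => nil_metric x i j) =
  cst (e i 0 0 * e j 0 0 + e i 0 1 * e j 0 1) +
  (fun x => contact_form x (e i)) * (fun x => contact_form x (e j)).
  by apply/funext => x; rewrite mxE /nil_g !fctE.
have dG := is_deriveD (is_derive_cst (e i 0 0 * e j 0 0 + e i 0 1 * e j 0 1) p
  (delta_mx 0 k)) (is_deriveM di dj).
by rewrite (@derive_val _ _ _ _ _ _ _ dG) add0r addrC [X in X + _]mulrC.
Qed.

Lemma vec3P (u : 'rV[R]_3) : exists x y z, u = vec3 x y z.
Proof.
by exists (u 0 0), (u 0 1), (u 0 2); apply/rowP; apply: ord3P; rewrite mxE.
Qed.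

(** The Christoffel symbol of the first kind of the metric. *)
Definition christoffel_lowered (p : 'rV[R]_3) (i j m : 'I_3) : R :=
  let alpha l := contact_form p (delta_mx 0 l) in
  2^-1 * ((contact_partial i j * alpha m + alpha j * contact_partial i m)
        + (contact_partial j i * alpha m + alpha i * contact_partial j m)
        - (contact_partial m i * alpha j + alpha i * contact_partial m j)).

Lemma christoffel_lowerE (p : 'rV[R]_3) i j m :
  \sum_k christoffel (@nil_metric R) p i j k * nil_metric p k m =
  christoffel_lowered p i j m.
Proof.
rewrite christoffel_lower ?nil_metric_unit //; last exact: nil_metric_sym.
by rewrite !nil_metric_partial.
Qed.

(** The [E3]-component of the Lorentz equation is its [m = 2] lowered
    component, and the [E1]- and [E2]-components are the [m = 0] and [m = 1]
    ones corrected by [- y / 2] and [x / 2] times the third, as in the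
    coordinates of [nilE1] and [nilE2]. *)
Lemma frame_equations (q : R) (p v a : 'rV[R]_3) :
  let w := contact_form p v in
  (forall m, \sum_k a 0 k * nil_metric p k m
     + \sum_i \sum_j christoffel_lowered p i j m * v 0 i * v 0 j
     = q * \sum_k nilJ p v 0 k * nil_metric p k m) ->
  [/\ a 0 0 = - (w + q) * v 0 1, a 0 1 = (w + q) * v 0 0
    & contact_form p a = 0].
Proof.
(* With scalar coordinates, every entry below computes to a polynomial. *)
case: (vec3P p) => x [y [z ->]]; case: (vec3P v) => v0 [v1 [v2 ->]].
case: (vec3P a) => a0 [a1 [a2 ->]] w low.
move: (low 0) (low 1) (low 2).
rewrite /w /christoffel_lowered !sum3E /nilJ /nilE1 /nilE2 !mxE.
rewrite /nil_g /contact_form /contact_partial !mxE /= => e0 e1 e2.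
have lincomb A B C D : A = B -> C - D = A - B -> C = D :> R.
  by move=> -> /eqP; rewrite subrr subr_eq0 => /eqP.
have e3 : a2 + 2^-1 * (y * a0 - x * a1) = 0 by apply: lincomb e2 _; field.
have e3y := congr1 (fun t => y / 2 * t) e3.
have e3x := congr1 (fun t => x / 2 * t) e3.
split; last exact: e3.
  by apply: (lincomb _ _ _ _ (congr2 (fun r t => r - t) e0 e3y)); field.
by apply: (lincomb _ _ _ _ (congr2 +%R e1 e3x)); field.
Qed.

(** The Lorentz equation in the left invariant frame.  The third conclusion
    says that [C := contact_form c c'] is constant along [c]: its derivative is
    [contact_form c c''], as the terms from differentiating the coefficients
    cancel. *)
Lemma geodesic_equations (q : R) (c : R -> 'rV[R]_3) s :
  let v := derive1 c s in let a := derive1 (derive1 c) s in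
  let w := contact_form (c s) v in
  covariant_derivative (@nil_metric R) c (derive1 c) s = q *: nilJ (c s) v ->
  [/\ a 0 0 = - (w + q) * v 0 1, a 0 1 = (w + q) * v 0 0
    & contact_form (c s) a = 0].
Proof.
move=> v a w eqn; apply: frame_equations => m.
transitivity ((covariant_derivative (@nil_metric R) c (derive1 c) s
    *m nil_metric (c s)) 0 m); last first.
  by rewrite eqn mxE mulr_sumr; apply: eq_bigr => k _; rewrite !mxE mulrA.
rewrite mxE; under [RHS]eq_bigr do rewrite mxE mulrDl.
rewrite big_split /=; congr (_ + _).
under [RHS]eq_bigr do rewrite mulr_suml.
rewrite [RHS]exchange_big /=; apply: eq_bigr => i _.
under [RHS]eq_bigr do rewrite mulr_suml.
rewrite [RHS]exchange_big /=; apply: eq_bigr => j _.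
rewrite -christoffel_lowerE !mulr_suml; apply: eq_bigr => k _.
by rewrite [RHS]mulrAC; congr (_ * _); rewrite mulrAC.
Qed.
End Geodesics.

(** * First integrals and orbits of the oscillator group *)

Section Orbits.
Context {R : realType}.

(** Here [x1], [x2] are the first two derivatives of [x], and likewise for [y]
    and [z].  Four quantities are conserved: [C], [x1 + w * y], [y1 - w * x]
    with [w] the constant value of [C + q], and the left side of [circle].  The
    last one turns the quadratic equation for [z1] into an affine one. *)
Lemma magnetic_first_integrals (I : set R) (q : R)
    (x y z x1 y1 z1 x2 y2 z2 : R -> R) :
  let C t := z1 t + 2^-1 * (y t * x1 t - x t * y1 t) in
  is_interval I -> I 0 -> x 0 = 0 -> y 0 = 0 ->
  (forall s, I s -> [/\ is_derive s (1 : R) x (x1 s), is_derive s (1 : R) y (y1 s)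
    & is_derive s (1 : R) z (z1 s)]) ->
  (forall s, I s -> [/\ is_derive s (1 : R) x1 (x2 s), is_derive s (1 : R) y1 (y2 s)
    & is_derive s (1 : R) z1 (z2 s)]) ->
  (forall s, I s -> [/\ x2 s = - (C s + q) * y1 s, y2 s = (C s + q) * x1 s
    & z2 s + 2^-1 * (y s * x2 s - x s * y2 s) = 0]) ->
  forall s, I s ->
    [/\ x1 s = x1 0 - (z1 0 + q) * y s, y1 s = y1 0 + (z1 0 + q) * x s
      & 2 * z1 s = 2 * z1 0 - y1 0 * x s + x1 0 * y s].
Proof.
move=> C Iint I0 x0 y0 d1 d2 eqs.
have const (f : R -> R) : (forall s, I s -> is_derive s (1 : R) f 0) ->
    forall s, I s -> f s = f 0.
  by move=> df s Is; exact: derive0_interval_constant Iint df s 0 Is I0.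
(* [C 0 = z1 0] because the curve starts on the z-axis. *)
have CE s : I s -> C s = z1 0.
  move=> Is; have -> : z1 0 = C 0 by rewrite /C x0 y0; ring.
  apply: const s Is => s Is.
  have [dx dy dz] := d1 s Is; have [dx1 dy1 dz1] := d2 s Is.
  rewrite (_ : C = z1 + 2^-1 \*: (y * x1 - x * y1)); last exact/funext.
  apply: is_derive_eq; have [_ _ <-] := eqs s Is.
  by rewrite /GRing.scale /=; ring.
set w := z1 0 + q.
have xE s : I s -> x1 s = x1 0 - w * y s.
  move=> Is; suff : x1 s + w * y s = x1 0 + w * y 0.
    by rewrite y0 mulr0 addr0 => <-; rewrite addrK.
  apply: (const (x1 + w \*: y)) s Is => s Is.
  have [dx dy dz] := d1 s Is; have [dx1 dy1 dz1] := d2 s Is.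
  apply: is_derive_eq; have [-> _ _] := eqs s Is; rewrite CE //.
  by rewrite /GRing.scale /w /=; ring.
have yE s : I s -> y1 s = y1 0 + w * x s.
  move=> Is; suff : y1 s - w * x s = y1 0 - w * x 0.
    by rewrite x0 mulr0 subr0 => <-; rewrite subrK.
  apply: (const (y1 - w \*: x)) s Is => s Is.
  have [dx dy dz] := d1 s Is; have [dx1 dy1 dz1] := d2 s Is.
  apply: is_derive_eq; have [_ -> _] := eqs s Is; rewrite CE //.
  by rewrite /GRing.scale /w /=; ring.
have circle s : I s ->
    w * (x s * x s + y s * y s) - 2 * x1 0 * y s + 2 * y1 0 * x s = 0.
  move=> Is; transitivity
    (w * (x 0 * x 0 + y 0 * y 0) - 2 * x1 0 * y 0 + 2 * y1 0 * x 0); last first.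
    by rewrite x0 y0; ring.
  apply: (const (w \*: (x * x + y * y) - (2 * x1 0) \*: y + (2 * y1 0) \*: x)) s Is.
  move=> s Is; have [dx dy dz] := d1 s Is.
  by apply: is_derive_eq; rewrite xE // yE // /GRing.scale /=; ring.
move=> s Is; split; [exact: xE|exact: yE|].
have := circle s Is; have := CE s Is; rewrite /C xE // yE // => <- e.
by apply: subr0_eq; rewrite -[RHS]e; field.
Qed.

Lemma osc_act0 (A : 'M[R]_4) :
  osc_act A 0 = vec3 (A 1 3) (A 2 3) (A 0 3 / 2).
Proof. by rewrite /osc_act !mxE; congr vec3; ring. Qed.

Lemma oscm_in_osc_m (u v w q : R) :
  exists2 W, W \in osc_m R & oscm u v w (w + q) = W + q *: oscE4 R.
Proof.
exists (u *: oscE1 R + v *: oscE2 R + w *: (oscE3 R + oscE4 R)).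
  by rewrite !memvD // memvZ // memv_span // !inE eqxx ?orbT.
apply/matrixP => i j; rewrite !mxE.
case: i => [[|[|[|[|//]]]] hi]; case: j => [[|[|[|[|//]]]] hj] /=; ring.
Qed.

(** The column of an element of the oscillator group that encodes where it
    moves the origin (see [osc_act0]). *)
Definition augmented (p : 'rV[R]_3) : 'cV[R]_4 :=
  \col_i [:: 2 * p 0 2; p 0 0; p 0 1; 1]`_i.

(** The hypotheses on [g] are the rows of
    [(augmented g)' = oscm u v w t * augmented g]. *)
Lemma osc_orbit_ode (I : set R) (g : R -> 'rV[R]_3) (u v w t : R) :
  is_interval I -> I 0 -> g 0 = 0 ->
  (forall s, I s -> [/\ is_derive s (1 : R) (fun r => g r 0 0) (u - t * g s 0 1),
    is_derive s (1 : R) (fun r => g r 0 1) (v + t * g s 0 0) &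
    is_derive s (1 : R) (fun r => g r 0 2)
      (w + 2^-1 * (u * g s 0 1 - v * g s 0 0))]) ->
  forall s, I s -> g s = osc_act (expmx (s *: oscm u v w t)) 0.
Proof.
move=> Iint I0 g0 dg s Is.
have X0 : augmented (g 0) = delta_mx 3 0.
  apply/colP => i; rewrite g0 !mxE eqxx andbT.
  by case: i => [[|[|[|[|//]]]] hi] /=; rewrite ?mulr0.
have dX r i (j : 'I_1) : I r -> is_derive r (1 : R) (fun t => augmented (g t) i j)
    ((oscm u v w t *m augmented (g r)) i j).
  move=> Ir; have [dx dy dz] := dg r Ir.
  under eq_fun do rewrite mxE.
  rewrite mxE !big_ord_recr big_ord0 /= !mxE /=.
  case: i => [[|[|[|[|//]]]] hi] /=.
  - by apply: is_derive_eq (is_deriveZ 2 dz) _; rewrite /GRing.scale /=; field.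
  - by apply: is_derive_eq dx _; ring.
  - by apply: is_derive_eq dy _; ring.
  - by apply: is_derive_eq (is_derive_cst _ _ _) _; ring.
have := expmx_ode Iint I0 dX Is.
rewrite X0 => XE.
have E i : augmented (g s) i 0 = expmx (s *: oscm u v w t) i 3.
  by rewrite XE -colE mxE.
rewrite osc_act0 -!E !mxE /=.
by apply/rowP; apply: ord3P; rewrite !mxE /=; field.
Qed.

End Orbits.

Theorem theorem10 (R : realType) (q : R) (I : set R) (gamma : R -> 'rV[R]_3)
    (I_open : open I) (I_interval : is_interval I) (I0 : I 0)
    (gamma_geodesic : contact_magnetic_geodesic q I gamma)
    (gamma0 : gamma 0 = 0) :
  Osc_homogeneous I gamma /\
  exists W : 'M[R]_4, W \in osc_m R /\
    forall s, I s -> gamma s = osc_act (expmx (s *: (W + q *: oscE4 R))) 0.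
Proof.
have [smooth geod] := gamma_geodesic.
pose v0 := derive1 gamma 0; pose u := v0 0 0; pose v := v0 0 1; pose w := v0 0 2.
have orbit s : I s -> gamma s = osc_act (expmx (s *: oscm u v w (w + q))) 0.
  apply: osc_orbit_ode => // {}s Is.
  have d m r i : I r -> is_derive r (1 : R) (fun t => derive1n m gamma t 0 i)
      (derive1n m.+1 gamma r 0 i).
    move=> Ir; apply: is_derive_mxP; apply: DeriveDef; first exact: smooth.
    by rewrite derive1nS derive1E.
  have gamma00 i : gamma 0 0 i = 0 by rewrite gamma0 mxE.
  have [||r Ir|r Ir|r Ir|x1E y1E z1E] := magnetic_first_integrals
    (x := fun t => gamma t 0 0) (y := fun t => gamma t 0 1)
    (z := fun t => gamma t 0 2) (x1 := fun t => derive1 gamma t 0 0)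
    (y1 := fun t => derive1 gamma t 0 1) (z1 := fun t => derive1 gamma t 0 2)
    (x2 := fun t => derive1 (derive1 gamma) t 0 0)
    (y2 := fun t => derive1 (derive1 gamma) t 0 1)
    (z2 := fun t => derive1 (derive1 gamma) t 0 2) (q := q)
    I_interval I0 _ _ _ _ _ Is.
  - exact: gamma00.
  - exact: gamma00.
  - by split; exact: (d 0%N).
  - by split; exact: (d 1%N).
  - exact: geodesic_equations (geod r Ir).
  split.
  - by rewrite -x1E; exact: (d 0%N).
  - by rewrite -y1E; exact: (d 0%N).
  - have -> : w + 2^-1 * (u * gamma s 0 1 - v * gamma s 0 0) = derive1 gamma s 0 2.
      by apply: (@mulfI R 2) => //; rewrite z1E /w /u /v /v0; field.
    exact: (d 0%N).
split.
  by exists (oscm u v w (w + q)); split=> //; exists u, v, w, (w + q).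
have [W Wm WE] := oscm_in_osc_m u v w q.
by exists W; split=> // s Is; rewrite -WE; exact: orbit.
Qed.
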